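(* Let $\mathcal{C}$ and $\mathcal{D}$ be conics such that there exists one quadrilateral inscribed in $\mathcal{C}$ and circumscribed about $\mathcal{D}$. Then any point on $\mathcal{C}$ is the vertex of some quadrilateral inscribed in $\mathcal{C}$ and circumscribed about $\mathcal{D}$.
   Context: The setting is the projective geometry of conics in the plane. A quadrilateral $A_1A_2A_3A_4$ is inscribed in a conic $\mathcal{C}$ if its vertices $A_1,A_2,A_3,A_4$ lie on $\mathcal{C}$, and it is circumscribed about a conic $\mathcal{D}$ if its side lines $A_1A_2$, $A_2A_3$, $A_3A_4$, $A_4A_1$ are tangent to $\mathcal{D}$. This is the case $n=4$ of Poncelet's closure theorem.
   Formalization: The plane is taken over an algebraically closed field of characteristic not 2, conics are nondegenerate, and at exceptional points of C (e.g. points also on D), where no quadrilateral with four distinct vertices exists, a closed degenerate (limit) quadrilateral is given instead. *)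

(* Defs.v *)
From mathcomp Require Import all_boot all_order all_algebra.

Set Implicit Arguments.
Unset Strict Implicit.
Unset Printing Implicit Defensive.

Import GRing.Theory.
Local Open Scope ring_scope.

(* Points and lines of the projective plane over F are nonzero vectors of     *)
(* 'rV[F]_3 (homogeneous coordinates). Two of them are the same point (line)  *)
(* iff they are proportional, i.e. iff (u == v)%MS.                           *)

Section Conics.

Variable F : fieldType.
Implicit Types (p q l : 'rV[F]_3) (S C D : 'M[F]_3) (A : 'I_4 -> 'rV[F]_3).

Definition incident p l : bool := p *m l^T == 0.

Definition joins p q l : bool := [&& l != 0, incident p l & incident q l].

(* A conic is given by the symmetric matrix of its equation p S p^T = 0; it   *)
(* is nondegenerate. The matrix determines the conic only for char F != 2.    *)
Definition is_conic S : bool := (S^T == S) && (S \in unitmx).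

Definition on_conic S p : bool := p *m S *m p^T == 0.

(* p *m S is half the gradient of the equation at p. *)
Definition tangent_at S p l : bool := on_conic S p && (l == p *m S)%MS.

Definition tangent S l : Prop := exists2 p, p != 0 & tangent_at S p l.

Definition quadrilateral A : Prop :=
  (forall i, A i != 0) /\ (forall i j, i != j -> ~~ (A i == A j)%MS).

Definition inscribed C A : Prop := forall i, on_conic C (A i).

(* The side lines are A_i A_(i+1), with i + 1 taken modulo 4 (ordS). *)
Definition circumscribed D A : Prop :=
  forall i l, joins (A i) (A (ordS i)) l -> tangent D l.

(* Limits of inscribed and circumscribed quadrilaterals, for which the side   *)
(* lines l must be given since consecutive vertices may coincide. A point of  *)
(* C that lies on D is on a single tangent of D, hence it is a vertex of no   *)
(* quadrilateral with four distinct vertices; likewise the contact point with *)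
(* C of a common tangent of C and D. Along the chain A_0 l_0 A_1 l_1 ...      *)
(* - A_i and A_(i+1) are the two intersections of l_i with C, counted with    *)
(*   multiplicity: they coincide only if l_i is tangent to C;                 *)
(* - l_i and l_(i+1) are the two tangents to D through A_(i+1), counted with  *)
(*   multiplicity: they coincide only if A_(i+1) is on D.                     *)
(* These two clauses exclude chains that merely turn back, such as            *)
(* A_0 A_1 A_0 A_1; the last clause of degenerate_poncelet requires that some *)
(* vertex or side really is exceptional, which never happens when the four    *)
(* vertices are distinct.                                                     *)
Definition poncelet_chain C D A (l : 'I_4 -> 'rV[F]_3) : Prop :=
  forall i,
    [/\ A i != 0 /\ on_conic C (A i),
        joins (A i) (A (ordS i)) (l i),
        tangent D (l i),
        (A i == A (ordS i))%MS -> tangent C (l i)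
      & (l i == l (ordS i))%MS -> on_conic D (A (ordS i))].

Definition degenerate_poncelet C D A : Prop :=
  exists2 l, poncelet_chain C D A l
           & exists i, on_conic D (A i) \/ tangent C (l i).

End Conics.

(* Main.v *)
Require Import Defs.
From mathcomp Require Import all_boot all_order all_algebra.
From mathcomp Require Import ring.

(******************************************************************************)
(* Take as reference triangle the diagonal triangle of the given              *)
(* quadrilateral, scaled so that the quadrilateral has vertices (1, +-1, +-1).*)
(* This triangle is self-polar for C, so C is diagonal, of the form           *)
(*   a x^2 + b y^2 = (a + b) z^2,                                             *)
(* and since x = +-z and y = +-z are tangent to D, the dual of D is           *)
(*   e (l^2 + m^2 - n^2) + 2 f l m = 0.                                       *)
(* Hence the reflection s : z |-> -z preserves both conics. For p, p' on C,   *)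
(* the condition that the line p p' be tangent to D is a product of C(p, p'), *)
(* which vanishes only for p = p', and of the form                            *)
(*   G(p, p') = e (x x' + y y') - f (x y' + y x'),                            *)
(* which does not involve z. So, given p on C and q on C with G(p, q) = 0,    *)
(* all four sides of p, q, s p, s q are tangent to D.                         *)
(******************************************************************************)

Set Implicit Arguments.
Unset Strict Implicit.
Unset Printing Implicit Defensive.

Import GRing.Theory.
Local Open Scope ring_scope.

(** * Coordinates in the projective plane *)

(** The coordinates come from [frame], the two equations from [inscribed_normal_form] and
    [circumscribed_normal_form]. The point is that tangency of a chord of C to D, quadratic in each
    end point, splits ([tangency_factor]), and its factor [facing] is symmetric, bilinear and blind
    to z. So [facing p q] already implies that q faces [flip p], that [flip p] faces [flip q] and
    that [flip q] faces p: the chain closes after four steps. Given p, the relation fixes the ratio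
    x' : y' for q, and C then fixes z' up to sign through a square root, which is where algebraic
    closure enters ([facing_exists]).

    The cycle p, q, s p, s q may have coincident vertices. For consecutive ones, the tangent to C at
    the common point serves as the side and is tangent to D ([facing_side]); for opposite ones, the
    vertex between them lies on D ([facing_fixed]). Together with [facing_turn], which controls
    equal successive sides, this gives in [facing_chain] either a genuine quadrilateral or a
    degenerate chain. *)

Section Coordinates.

Variable F : fieldType.
Implicit Types (x y z k : F) (p q r l m : 'rV[F]_3) (S : 'M[F]_3).

Definition row3 x y z : 'rV[F]_3 := \row_j nth 0 [:: x; y; z] j.

Definition cross p q : 'rV[F]_3 :=
  row3 (p 0 1 * q 0 2 - p 0 2 * q 0 1) (p 0 2 * q 0 0 - p 0 0 * q 0 2)
       (p 0 0 * q 0 1 - p 0 1 * q 0 0).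

Lemma row3E x y z :
  (row3 x y z 0 0 = x) * (row3 x y z 0 1 = y) * (row3 x y z 0 2 = z).
Proof. by rewrite !mxE. Qed.

Lemma ord3P (i : 'I_3) : [\/ i = 0, i = 1 | i = 2].
Proof.
case: i => [[|[|[|//]]] Hi]; [apply: Or31|apply: Or32|apply: Or33];
  exact: val_inj.
Qed.

Lemma row3_ext p q :
  p 0 0 = q 0 0 -> p 0 1 = q 0 1 -> p 0 2 = q 0 2 -> p = q.
Proof.
by move=> h0 h1 h2; apply/rowP => i; case: (ord3P i) => ->.
Qed.

Lemma mulmx3E (n1 n2 : nat) (A : 'M[F]_(n1, 3)) (B : 'M[F]_(3, n2)) i j :
  (A *m B) i j = A i 0 * B 0 j + A i 1 * B 1 j + A i 2 * B 2 j.
Proof.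
rewrite mxE !big_ord_recl big_ord0 addr0 addrA.
have -> : lift ord0 ord0 = 1 :> 'I_3 by apply: val_inj.
by have -> : lift ord0 (lift ord0 ord0) = 2 :> 'I_3 by apply: val_inj.
Qed.

Lemma scalar_mx1_eq0 (A : 'M[F]_1) : (A == 0) = (A 0 0 == 0).
Proof.
apply/eqP/eqP => [-> | h]; first by rewrite mxE.
by apply/matrixP=> i j; rewrite !ord1 h mxE.
Qed.

Lemma incident3E p l :
  incident p l =
  (p 0 0 * l 0 0 + p 0 1 * l 0 1 + p 0 2 * l 0 2 == 0).
Proof. by rewrite /incident scalar_mx1_eq0 mulmx3E !mxE. Qed.

Lemma row3_neq0 p : p != 0 -> [|| p 0 0 != 0, p 0 1 != 0 | p 0 2 != 0].
Proof.
apply: contraNT; rewrite !negb_or !negbK => /and3P[/eqP h0 /eqP h1 /eqP h2].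
by apply/eqP/row3_ext; rewrite mxE.
Qed.

Lemma proportionalP p q : p != 0 -> q != 0 ->
  reflect (exists2 k, k != 0 & q = k *: p) (p == q)%MS.
Proof.
move=> p0 q0; apply: (iffP andP) => [[_ /sub_rVP[k qE]] | [k k0 ->]].
  by exists k => //; apply: contra q0 => /eqP k0; rewrite qE k0 scale0r.
split; apply/sub_rVP; last by exists k.
by exists k^-1; rewrite scalerA mulVf ?scale1r.
Qed.

Lemma cross_eq0 p q : p != 0 -> q != 0 -> (cross p q == 0) = (p == q)%MS.
Proof.
move=> p0 q0; apply/eqP/(proportionalP p0 q0) => [h | [k _ ->]]; last first.
  by apply: row3_ext; rewrite !row3E !mxE; ring.
have key k : k != 0 -> k *: q = p -> exists2 k, k != 0 & q = k *: p.
  move=> k0 <-; exists k^-1; rewrite ?invr_eq0 //.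
  by rewrite scalerA mulVf ?scale1r.
have /rowP h0 := h; move: (h0 0) (h0 1) (h0 2); rewrite !row3E !mxE.
move=> {h0} /subr0_eq h0 /subr0_eq h1 /subr0_eq h2.
have main (i : 'I_3) : p 0 i != 0 ->
    (forall j, p 0 i * q 0 j = p 0 j * q 0 i) ->
    exists2 k, k != 0 & q = k *: p.
  move=> pi0 hi; exists (q 0 i / p 0 i); last first.
    apply/rowP => j; rewrite !mxE; apply: (mulfI pi0); rewrite hi.
    by field.
  rewrite mulf_neq0 ?invr_eq0 //; apply: contra q0 => /eqP qi0.
  apply/eqP/rowP => j; rewrite mxE; apply: (mulfI pi0).
  by rewrite hi qi0 !mulr0.
case/or3P: (row3_neq0 p0) => pi0; apply: main pi0 _ => j;
  by case: (ord3P j) => -> //; rewrite -?h0 -?h1 -?h2 // mulrC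
                                       ?h0 ?h1 ?h2 mulrC.
Qed.

Lemma joins_cross p q : p != 0 -> q != 0 -> ~~ (p == q)%MS ->
  joins p q (cross p q).
Proof.
move=> p0 q0; rewrite -cross_eq0 // => c0; rewrite /joins c0 /=.
by rewrite !incident3E !row3E; apply/andP; split; apply/eqP; ring.
Qed.

(** Vector triple product expansion; it makes every line through p and q proportional to
    [cross p q]. *)
Lemma cross_cross p q l :
  cross (cross p q) l = (p *m l^T) 0 0 *: q - (q *m l^T) 0 0 *: p.
Proof.
by rewrite !mulmx3E; apply: row3_ext; rewrite !row3E !mxE; ring.
Qed.

Lemma joins_uniq p q l : p != 0 -> q != 0 -> ~~ (p == q)%MS ->
  joins p q l -> exists2 k, k != 0 & l = k *: cross p q.
Proof.
move=> p0 q0 pq /and3P[l0].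
rewrite !incident3E => /eqP hp /eqP hq.
have c0 : cross p q != 0 by rewrite cross_eq0.
apply/(proportionalP c0 l0); rewrite -cross_eq0 //.
by rewrite cross_cross !mulmx3E !mxE hp hq !scale0r subr0.
Qed.

Lemma on_conicZ S k p : k != 0 -> on_conic S (k *: p) = on_conic S p.
Proof.
move=> k0; rewrite /on_conic linearZ /= -!scalemxAl -scalemxAr scalerA.
by rewrite scaler_eq0 mulf_eq0 !(negPf k0).
Qed.

Lemma incidentZ k p l : k != 0 -> incident (k *: p) l = incident p l.
Proof.
by move=> k0; rewrite /incident -scalemxAl scaler_eq0 (negPf k0).
Qed.

Lemma tangentZ S k l : k != 0 -> tangent S l -> tangent S (k *: l).
Proof.
move=> k0 [p p0 /andP[Sp lE]]; exists p => //; rewrite /tangent_at Sp.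
by rewrite !(eqmx_scale _ k0).
Qed.

Lemma mulmx_unit_neq0 n (S : 'M[F]_n) (v : 'rV[F]_n) :
  S \in unitmx -> v != 0 -> v *m S != 0.
Proof.
by move=> uS; apply: contra => /eqP h; rewrite -(mulmxK uS v) h mul0mx.
Qed.

Lemma incident_eqmx p l m : (l == m)%MS -> incident p l -> incident p m.
Proof.
move=> /andP[_ /sub_rVP[k ->]] /eqP pl.
by rewrite /incident linearZ /= -scalemxAr pl scaler0.
Qed.

(** * Polarity and tangency for a single conic *)

Section Conic.

Variable S : 'M[F]_3.
Hypothesis conicS : is_conic S.

Let symS : S^T = S. Proof. by case/andP: conicS => /eqP. Qed.
Let unitS : S \in unitmx. Proof. by case/andP: conicS. Qed.

Lemma conjugateC p q : p *m S *m q^T = q *m S *m p^T.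
Proof.
have tr11 (A : 'M[F]_1) : A^T = A by apply/matrixP=> i j; rewrite mxE !ord1.
by rewrite -[LHS]tr11 !trmx_mul trmxK symS mulmxA.
Qed.

(** Substituting the polar [l = p S] turns the equation of the conic at p into that of the dual
    conic, with matrix [invmx S], at l. *)
Lemma tangentP l : l != 0 ->
  tangent S l <-> l *m invmx S *m l^T = 0.
Proof.
move=> l0; split=> [[p p0 /andP[/eqP Sp]] | lSl].
  case/(proportionalP l0 (mulmx_unit_neq0 unitS p0)) => k k0 pE.
  have -> : l = k^-1 *: (p *m S) by rewrite pE scalerA mulVf ?scale1r.
  rewrite linearZ /= trmx_mul symS -!scalemxAl -scalemxAr.
  by rewrite mulmxK // mulmxA Sp !scaler0.
exists (l *m invmx S).
  by rewrite mulmx_unit_neq0 ?unitmx_inv.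
rewrite /tangent_at /on_conic mulmxKV // !submx_refl !andbT.
by rewrite trmx_mul trmx_inv symS mulmxA lSl eqxx.
Qed.

(** Otherwise the line p q would be the polar of both p and q, but an invertible polarity is
    injective. *)
Lemma conjugate_on_conic p q : p != 0 -> q != 0 ->
  on_conic S p -> on_conic S q -> p *m S *m q^T = 0 -> (p == q)%MS.
Proof.
move=> p0 q0 Sp Sq pq; apply: contraT => npq.
have jp : joins p q (p *m S).
  rewrite /joins mulmx_unit_neq0 //= /incident trmx_mul symS mulmxA.
  by rewrite -/(on_conic S p) Sp mulmxA conjugateC pq eqxx.
have jq : joins p q (q *m S).
  rewrite /joins mulmx_unit_neq0 //= /incident trmx_mul symS !mulmxA.
  by rewrite -/(on_conic S q) Sq pq eqxx.
have [a a0 pE] := joins_uniq p0 q0 npq jp.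
have [b b0 qE] := joins_uniq p0 q0 npq jq.
case/negP: npq; apply/(proportionalP p0 q0); exists (b / a).
  by rewrite mulf_neq0 ?invr_eq0.
rewrite -(mulmxK unitS q) -[in RHS](mulmxK unitS p) pE qE -!scalemxAl scalerA.
by rewrite divfK.
Qed.

Hypothesis char_neq2 : (2%:R : F) != 0.

Lemma line_meets_conic_twice p q r a b : p != 0 -> q != 0 -> r != 0 ->
  on_conic S p -> on_conic S q -> on_conic S r -> r = a *: p + b *: q ->
  [|| (p == q)%MS, (p == r)%MS | (q == r)%MS].
Proof.
move=> p0 q0 r0 Sp Sq Sr rE.
(* In the expansion of the form at r only the mixed term survives. *)
have /eqP : (2%:R * (a * b)) *: (p *m S *m q^T) = 0.
  move: Sp Sq Sr; rewrite /on_conic rE !linearD /= !linearZ /= !mulmxDl.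
  rewrite -!scalemxAl (conjugateC q p) => /eqP -> /eqP -> /eqP.
  rewrite !scaler0 add0r addr0 !scalerA [b * a]mulrC -scalerDl => <-.
  by congr (_ *: _); ring.
rewrite scaler_eq0 !mulf_eq0 (negPf char_neq2) /= => /orP[/orP[]|] /eqP h.
- have b0 : b != 0.
    by apply: contra r0 => /eqP b0; rewrite rE h b0 !scale0r addr0.
  apply/or3P/Or33/(proportionalP q0 r0); exists b => //.
  by rewrite rE h scale0r add0r.
- have a0 : a != 0.
    by apply: contra r0 => /eqP a0; rewrite rE h a0 !scale0r addr0.
  apply/or3P/Or32/(proportionalP p0 r0); exists a => //.
  by rewrite rE h scale0r addr0.
- by apply/or3P/Or31/conjugate_on_conic.
Qed.

End Conic.

(** * Projective frame of an inscribed quadrilateral *)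

Lemma mul_row3_mx n (p q r : 'rV[F]_n) (v : 'rV[F]_3) :
  v *m (\matrix_(i < 3) nth 0 [:: p; q; r] i) =
  v 0 0 *: p + v 0 1 *: q + v 0 2 *: r.
Proof. by apply/rowP => j; rewrite mulmx3E !mxE. Qed.

(* The vertices, in cyclic order, of a quadrilateral with respect to its      *)
(* diagonal triangle.                                                         *)
Definition standard_vertex (i : nat) : 'rV[F]_3 :=
  nth 0 [:: row3 1 1 1; row3 1 (-1) 1; row3 1 1 (-1); row3 1 (-1) (-1)] i.

(** A line meets the conic at most twice, so no three vertices are collinear, and four points in
    general position form a projective frame. *)
Lemma frame S (A : 'I_4 -> 'rV[F]_3) :
  is_conic S -> (2%:R : F) != 0 -> quadrilateral A -> inscribed S A ->
  exists2 B : 'M[F]_3, B \in unitmx &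
    forall i, exists2 k : F, k != 0 & A i = k *: (standard_vertex i *m B).
Proof.
move=> conicS two0 [A0 Aneq] SA.
pose U : 'M[F]_3 := \matrix_(i < 3) nth 0 [:: A 0; A 1; A 2] i.
have indep (i j k : 'I_4) (a b : F) : i != j -> j != k -> i != k ->
    A k <> a *: A i + b *: A j.
  move=> ij jk ik Ak.
  have := line_meets_conic_twice conicS two0 (A0 i) (A0 j) (A0 k) (SA i) (SA j)
    (SA k) Ak.
  by rewrite !(negPf (Aneq _ _ _)).
have unitU : U \in unitmx.
  rewrite unitmxE unitfE; apply/negP => /det0P[v v0]; rewrite mul_row3_mx => vU.
  have solve x y z (u1 u2 u3 : 'rV[F]_3) : x != 0 ->
      x *: u1 + y *: u2 + z *: u3 = 0 ->
      u1 = - (y / x) *: u2 + - (z / x) *: u3.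
    move=> x0 /rowP h; apply/rowP => i; apply: (mulfI x0).
    move: (h i); rewrite !mxE -addrA => /(canRL (addrK _)) ->; by field.
  case/or3P: (row3_neq0 v0) => vi.
  - exact: (@indep 1 2 0 _ _ isT isT isT (solve _ _ _ _ _ _ vi vU)).
  - apply: (@indep 0 2 1 _ _ isT isT isT (solve _ (v 0 0) (v 0 2) _ _ _ vi _)).
    by rewrite -vU [X in _ = X + _]addrC.
  - apply: (@indep 0 1 2 _ _ isT isT isT (solve _ (v 0 0) (v 0 1) _ _ _ vi _)).
    by rewrite -vU [RHS]addrC addrA.
have [a] : exists a, A 3 = a *m U.
  by exists (A 3 *m invmx U); rewrite mulmxKV.
rewrite mul_row3_mx => aE.
have a0 : a 0 0 != 0.
  apply/eqP => h; have [] := @indep 1 2 3 (a 0 1) (a 0 2) isT isT isT.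
  by rewrite aE h scale0r add0r.
have a1 : a 0 1 != 0.
  apply/eqP => h; have [] := @indep 0 2 3 (a 0 0) (a 0 2) isT isT isT.
  by rewrite aE h scale0r addr0.
have a2 : a 0 2 != 0.
  apply/eqP => h; have [] := @indep 0 1 3 (a 0 0) (a 0 1) isT isT isT.
  by rewrite aE h scale0r addr0.
(* The rows are the diagonal points: by [aE] they also equal [A 3 - a0 A0], [a2 A2 - A 3] and
   [a1 A1 - A 3]. They are scaled so that the sign combinations of [standard_vertex] are multiples
   of the [A i]. *)
pose B : 'M[F]_3 := \matrix_(i < 3) nth 0
  [:: a 0 1 *: A 1 + a 0 2 *: A 2; - a 0 0 *: A 0 - a 0 1 *: A 1;
      - a 0 0 *: A 0 - a 0 2 *: A 2] i.
exists B.
  rewrite unitmxE unitfE; apply/negP => /det0P[v /negP v0]; rewrite mul_row3_mx.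
  (* [w] holds the coordinates of [v *m B] in the basis [A 0], [A 1], [A 2]. *)
  pose w := row3 (- (v 0 1 + v 0 2) * a 0 0) ((v 0 0 - v 0 1) * a 0 1)
                 ((v 0 0 - v 0 2) * a 0 2).
  have -> : v 0 0 *: (a 0 1 *: A 1 + a 0 2 *: A 2) +
            v 0 1 *: (- a 0 0 *: A 0 - a 0 1 *: A 1) +
            v 0 2 *: (- a 0 0 *: A 0 - a 0 2 *: A 2) = w *m U.
    by rewrite mul_row3_mx !row3E; apply/rowP => j; rewrite !mxE; ring.
  move=> wU; have w0 : w = 0 by rewrite -(mulmxK unitU w) wU mul0mx.
  have := row3E (- (v 0 1 + v 0 2) * a 0 0) ((v 0 0 - v 0 1) * a 0 1)
                ((v 0 0 - v 0 2) * a 0 2).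
  rewrite -/w w0 !mxE => -[[h0 h1] h2].
  have {}h0 : v 0 1 = - v 0 2.
    by apply/eqP; rewrite -addr_eq0 -oppr_eq0 -(mulIr_eq0 _ (mulIf a0)) -h0.
  have {}h1 : v 0 0 = v 0 1.
    by apply/eqP; rewrite -subr_eq0 -(mulIr_eq0 _ (mulIf a1)) -h1.
  have {}h2 : v 0 0 = v 0 2.
    by apply/eqP; rewrite -subr_eq0 -(mulIr_eq0 _ (mulIf a2)) -h2.
  have v2 : v 0 2 = 0.
    have v2N : v 0 2 = - v 0 2 by rewrite -[LHS]h2 h1.
    by apply: (mulfI two0); rewrite mulr0 mulr_natl mulr2n {1}v2N addNr.
  by apply: v0; apply/eqP/row3_ext; rewrite !mxE ?h2 ?v2 // -h1 h2.
have scal (k : F) (u w : 'rV[F]_3) :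
    k != 0 -> w = k *: u -> exists2 k : F, k != 0 & u = k *: w.
  move=> k0 ->; exists k^-1; first by rewrite invr_eq0.
  by rewrite scalerA mulVf ?scale1r.
case=> -[|[|[|[|//]]]] Hi; rewrite mul_row3_mx !row3E /=.
- have -> : Ordinal Hi = 0 by apply: val_inj.
  apply: (scal (- 2%:R * a 0 0)); first by rewrite mulf_neq0 ?oppr_eq0.
  by apply/rowP => j; rewrite !mxE; ring.
- have -> : Ordinal Hi = 1 by apply: val_inj.
  apply: (scal (2%:R * a 0 1)); first by rewrite mulf_neq0.
  by apply/rowP => j; rewrite !mxE; ring.
- have -> : Ordinal Hi = 2 by apply: val_inj.
  apply: (scal (2%:R * a 0 2)); first by rewrite mulf_neq0.
  by apply/rowP => j; rewrite !mxE; ring.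
- have -> : Ordinal Hi = 3 by apply: val_inj.
  apply: (scal 2%:R) => //; rewrite aE.
  by apply/rowP => j; rewrite !mxE; ring.
Qed.

End Coordinates.

(** * Conics in normal form *)

Section StandardFrame.

Variable F : fieldType.
Implicit Types (p q r l m : 'rV[F]_3) (A : 'I_4 -> 'rV[F]_3).
Hypothesis two0 : (2%:R : F) != 0.
Variables (C D : 'M[F]_3) (a b e f : F).
Hypotheses (conicC : is_conic C).
Hypothesis polarC : forall p,
  p *m C = row3 (a * p 0 0) (b * p 0 1) (- (a + b) * p 0 2).
Hypothesis tangentD : forall l, l != 0 ->
  e * (l 0 0 ^+ 2 + l 0 1 ^+ 2 - l 0 2 ^+ 2) + 2%:R * f * l 0 0 * l 0 1 = 0 ->
  tangent D l.
(** The point equation dual to the line equation in [tangentD], with denominators cleared. *)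
Hypothesis onD : forall p,
  e * (e * (p 0 0 ^+ 2 + p 0 1 ^+ 2) - 2%:R * f * p 0 0 * p 0 1) =
    (e ^+ 2 - f ^+ 2) * p 0 2 ^+ 2 ->
  on_conic D p.
Hypotheses (ab0 : a + b != 0) (ef0 : e ^+ 2 - f ^+ 2 != 0).

(** The harmonic homology with centre (0, 0, 1) and axis z = 0, written s in the overview. *)
Definition flip p := row3 (p 0 0) (p 0 1) (- p 0 2).

(* The condition G(p, q) = 0. *)
Definition facing p q :=
  e * (p 0 0 * q 0 0 + p 0 1 * q 0 1) - f * (p 0 0 * q 0 1 + p 0 1 * q 0 0) = 0.

Lemma conjugateE p q :
  (p *m C *m q^T == 0) =
  (a * p 0 0 * q 0 0 + b * p 0 1 * q 0 1 == (a + b) * p 0 2 * q 0 2).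
Proof.
rewrite scalar_mx1_eq0 mulmx3E polarC !row3E !mxE -[RHS]subr_eq0.
by congr (_ == 0); ring.
Qed.

Lemma on_conicE p : on_conic C p =
  (a * p 0 0 ^+ 2 + b * p 0 1 ^+ 2 == (a + b) * p 0 2 ^+ 2).
Proof. by rewrite /on_conic conjugateE -!mulrA -!expr2. Qed.

Lemma flipK : involutive flip.
Proof. by move=> p; apply: row3_ext; rewrite !row3E ?opprK. Qed.

Lemma flip_neq0 p : p != 0 -> flip p != 0.
Proof.
apply: contra => /eqP h; rewrite -(flipK p) h; apply/eqP.
by apply: row3_ext; rewrite !row3E !mxE ?oppr0.
Qed.

Lemma on_conic_flip p : on_conic C (flip p) = on_conic C p.
Proof. by rewrite !on_conicE !row3E sqrrN. Qed.

Lemma facing_flip p q : facing p q -> facing q (flip p).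
Proof. by rewrite /facing !row3E => <-; ring. Qed.

Lemma on_conic_neq0 p : p != 0 -> on_conic C p ->
  (p 0 0 != 0) || (p 0 1 != 0).
Proof.
move=> p0; rewrite on_conicE; apply: contraTT.
rewrite negb_or !negbK => /andP[/eqP h0 /eqP h1].
have:= row3_neq0 p0; rewrite h0 h1 eqxx /= => h2.
by rewrite expr0n !mulr0 addr0 eq_sym mulf_neq0 // sqrf_eq0.
Qed.

Lemma flip_eqmx p : p != 0 -> on_conic C p -> (p == flip p)%MS -> p 0 2 = 0.
Proof.
move=> p0 Cp; rewrite -cross_eq0 ?flip_neq0 // => /eqP/rowP h.
have {}h : 2%:R * p 0 1 * p 0 2 = 0 /\ 2%:R * p 0 0 * p 0 2 = 0.
  move: (h 0) (h 1); rewrite !row3E !mxE => h0 h1.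
  by split; [rewrite -[RHS]oppr0 -h0 | rewrite -h1]; ring.
case: h => /eqP + /eqP; rewrite !mulf_eq0 (negPf two0) /=.
have := on_conic_neq0 p0 Cp.
by case: (p 0 0 =P 0); case: (p 0 1 =P 0) => //= _ _ _ /eqP + /eqP.
Qed.

(** A line through the centre of the reflection meets C only in a point and its mirror image. *)
Lemma on_conic_collinear_flip p q : p != 0 -> q != 0 ->
  on_conic C p -> on_conic C q ->
  p 0 0 * q 0 1 = p 0 1 * q 0 0 -> (p == q)%MS || (q == flip p)%MS.
Proof.
move=> p0 q0 Cp Cq h.
have [k x1 y1] : exists2 k, q 0 0 = k * p 0 0 & q 0 1 = k * p 0 1.
  case/orP: (on_conic_neq0 p0 Cp) => n0.
    exists (q 0 0 / p 0 0); first by rewrite divfK.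
    by apply: (mulfI n0); rewrite h; field.
  exists (q 0 1 / p 0 1); last by rewrite divfK.
  by apply: (mulfI n0); rewrite -h; field.
have k0 : k != 0.
  apply/eqP => k0; have := on_conic_neq0 q0 Cq.
  by rewrite x1 y1 k0 !mul0r eqxx.
have : (a + b) * (q 0 2 ^+ 2 - (k * p 0 2) ^+ 2) == 0.
  move: Cp Cq; rewrite !on_conicE x1 y1 => /eqP Cp /eqP Cq.
  rewrite mulrBr -Cq [(k * p 0 2) ^+ 2]exprMn (mulrCA (a + b)) -Cp.
  by apply/eqP; ring.
rewrite mulf_eq0 (negPf ab0) /= subr_eq0 eqf_sqr => /orP[]/eqP z1.
  apply/orP; left; apply/proportionalP => //; exists k => //.
  by apply: row3_ext; rewrite !mxE.
apply/orP; right; rewrite andbC; apply/proportionalP; rewrite ?flip_neq0 //.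
exists k => //.
by apply: row3_ext; rewrite [RHS]mxE !row3E // mulrN.
Qed.

(** The z-coordinates enter the left side only through their squares and their product. Eliminating
    the squares by the equation of C leaves G(p, q) times the polar form of C. *)
Lemma tangency_factor p q : on_conic C p -> on_conic C q ->
  let l := cross p q in
  (a + b) * (e * (l 0 0 ^+ 2 + l 0 1 ^+ 2 - l 0 2 ^+ 2)
             + 2%:R * f * l 0 0 * l 0 1) =
  2%:R * (e * (p 0 0 * q 0 0 + p 0 1 * q 0 1)
          - f * (p 0 0 * q 0 1 + p 0 1 * q 0 0))
  * (a * p 0 0 * q 0 0 + b * p 0 1 * q 0 1 - (a + b) * p 0 2 * q 0 2).
Proof.
rewrite !on_conicE => /eqP Cp /eqP Cq /=; rewrite !row3E.
apply/eqP; rewrite -subr_eq0.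
(* The difference is a combination of the two equations of C, with coefficients G(q, q) and G(p,
   p). *)
rewrite (_ : _ - _ =
  (e * (q 0 0 ^+ 2 + q 0 1 ^+ 2) - 2%:R * f * q 0 0 * q 0 1)
  * ((a + b) * p 0 2 ^+ 2 - (a * p 0 0 ^+ 2 + b * p 0 1 ^+ 2)) +
  (e * (p 0 0 ^+ 2 + p 0 1 ^+ 2) - 2%:R * f * p 0 0 * p 0 1)
  * ((a + b) * q 0 2 ^+ 2 - (a * q 0 0 ^+ 2 + b * q 0 1 ^+ 2))); last by ring.
by rewrite Cp Cq !subrr !mulr0 addr0.
Qed.

(** For distinct points this is [tangency_factor]; for coincident ones the chord is replaced by its
    limit, the tangent to C. *)
Lemma facing_side p q : p != 0 -> q != 0 -> on_conic C p -> on_conic C q ->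
  facing p q ->
  exists l, [/\ joins p q l, tangent D l & (p == q)%MS -> (l == p *m C)%MS].
Proof.
move=> p0 q0 Cp Cq pq.
have [Epq|Npq] := boolP (p == q)%MS; last first.
  exists (cross p q); have jpq := joins_cross p0 q0 Npq; split=> //.
  case/and3P: jpq => l0 _ _; apply: tangentD => //.
  by apply: (mulfI ab0); rewrite tangency_factor // pq !mulr0 mul0r.
have unitC : C \in unitmx by case/andP: conicC.
case/(proportionalP p0 q0): (Epq) => k k0 qE.
exists (p *m C); split=> [||_]; last by rewrite !submx_refl.
  rewrite /joins mulmx_unit_neq0 //= qE incidentZ // andbb.
  by case/andP: conicC => /eqP sC _; rewrite /incident trmx_mul sC mulmxA.
apply: tangentD; rewrite ?mulmx_unit_neq0 // polarC !row3E.
have {}pq : facing p p.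
  move: pq; rewrite /facing qE !mxE => pq; apply: (mulfI k0).
  by rewrite mulr0 -pq; ring.
move: Cp pq; rewrite on_conicE /facing => /eqP Cp pq.
(* Modulo the equation of C, the tangency form at the polar of p is [- a * b] times G(p, p). *)
transitivity (- a * b * (e * (p 0 0 * p 0 0 + p 0 1 * p 0 1) -
     f * (p 0 0 * p 0 1 + p 0 1 * p 0 0))
   + e * (a + b) * ((a * p 0 0 ^+ 2 + b * p 0 1 ^+ 2) - (a + b) * p 0 2 ^+ 2)).
  by ring.
by rewrite pq Cp subrr !mulr0 addr0.
Qed.

(** The coefficients of q in G(p, q) arise from (x, y) by a matrix of determinant
    [e ^+ 2 - f ^+ 2]. *)
Lemma facing_line_neq0 p : p != 0 -> on_conic C p ->
  (e * p 0 0 - f * p 0 1 != 0) || (e * p 0 1 - f * p 0 0 != 0).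
Proof.
move=> p0 Cp; have := on_conic_neq0 p0 Cp; apply: contraTT.
rewrite !negb_or !negbK => /andP[/eqP h0 /eqP h1].
apply/andP; split; apply/eqP/(mulfI ef0); rewrite mulr0.
  transitivity (e * (e * p 0 0 - f * p 0 1) + f * (e * p 0 1 - f * p 0 0));
    first by ring.
  by rewrite h0 h1 !mulr0 addr0.
transitivity (f * (e * p 0 0 - f * p 0 1) + e * (e * p 0 1 - f * p 0 0));
  first by ring.
by rewrite h0 h1 !mulr0 addr0.
Qed.

(** On the axis p = s p, so the two tangents to D from q merge. *)
Lemma facing_fixed p q : p != 0 -> on_conic C p -> on_conic C q ->
  facing p q -> p 0 2 = 0 -> on_conic D q.
Proof.
move=> p0 Cp Cq pq z0.
have [k x1 y1] : exists2 k, q 0 0 = k * (e * p 0 1 - f * p 0 0)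
                          & q 0 1 = - k * (e * p 0 0 - f * p 0 1).
  have h : (e * p 0 0 - f * p 0 1) * q 0 0 =
      - (e * p 0 1 - f * p 0 0) * q 0 1.
    by apply/eqP; rewrite -subr_eq0 -pq; apply/eqP; ring.
  case/orP: (facing_line_neq0 p0 Cp) => n0.
    exists (- q 0 1 / (e * p 0 0 - f * p 0 1)).
      by apply: (mulfI n0); rewrite h; field.
    by rewrite -mulNr opprK divfK.
  exists (q 0 0 / (e * p 0 1 - f * p 0 0)); first by rewrite divfK.
  apply: (mulfI n0); rewrite -[LHS]opprK -mulNr -h; by field.
apply: onD; apply: (mulfI ab0).
move: Cp Cq; rewrite !on_conicE z0 expr0n /= mulr0 => /eqP Cp /eqP Cq.
rewrite [RHS]mulrCA -Cq x1 y1; apply/eqP; rewrite -subr_eq0; apply/eqP.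
(* The equation of D at q has become a multiple of the equation of C at p. *)
transitivity ((e ^+ 2 - f ^+ 2) * k ^+ 2 * (e ^+ 2 - f ^+ 2)
              * (a * p 0 0 ^+ 2 + b * p 0 1 ^+ 2)).
  by ring.
by rewrite Cp mulr0.
Qed.

(* Two equal sides through q would meet C in p, q and s p, hence p = s p.     *)
Lemma facing_turn p q l m :
  p != 0 -> q != 0 -> on_conic C p -> on_conic C q -> facing p q ->
  joins p q l -> ((p == q)%MS -> (l == p *m C)%MS) ->
  joins q (flip p) m -> ((q == flip p)%MS -> (m == q *m C)%MS) ->
  (l == m)%MS -> on_conic D q.
Proof.
move=> p0 q0 Cp Cq pq /and3P[l0 pl ql] lE /and3P[m0 qm pm] mE lm.
have [z0|z0] := eqVneq (p 0 2) 0; first exact: (facing_fixed p0 Cp Cq pq z0).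
have sC : C^T = C by case/andP: conicC => /eqP.
have f0 := flip_neq0 p0.
have Cf : on_conic C (flip p) by rewrite on_conic_flip.
have npf : ~~ (p == flip p)%MS.
  by apply/negP => /(flip_eqmx p0 Cp)/eqP; apply/negP.
have ml : (m == l)%MS by rewrite andbC.
have fl := incident_eqmx ml pm.
have [k k0 lk] := joins_uniq p0 f0 npf (introT and3P (And3 l0 pl fl)).
have /(on_conic_collinear_flip p0 q0 Cp Cq) : p 0 0 * q 0 1 = p 0 1 * q 0 0.
  move: ql; rewrite lk incident3E !mxE /= => /eqP h.
  apply: (mulfI two0); apply: (mulfI z0); apply: (mulfI k0).
  apply/eqP; rewrite -subr_eq0 -h; apply/eqP; ring.
(* If q = p, then l is the tangent to C at p and contains s p; if q = s p, then m is the tangent to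
   C at q and contains p. Conjugate points of C coincide, so p = s p in both cases. *)
case/orP => [epq | eqf].
  case/negP: npf; apply: (conjugate_on_conic conicC) => //.
  have /eqP := incident_eqmx (lE epq) fl.
  by rewrite trmx_mul sC mulmxA (conjugateC conicC).
case/negP: npf.
have epq : (p == q)%MS.
  apply: (conjugate_on_conic conicC) => //.
  have /eqP := incident_eqmx (mE eqf) (incident_eqmx lm pl).
  by rewrite trmx_mul sC mulmxA.
by rewrite !(eqmxP epq).
Qed.

(** Between distinct vertices the side is unique up to scaling, hence is the tangent found by
    [facing_side]. A coincidence supplies the exceptional side (consecutive vertices) or the
    exceptional vertex (opposite ones) that [degenerate_poncelet] asks for. *)
Lemma facing_chain A :
  (forall i, A i != 0) -> inscribed C A ->
  (forall i, facing (A i) (A (ordS i))) ->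
  (forall i, A (ordS (ordS i)) = flip (A i)) ->
  [/\ quadrilateral A, inscribed C A & circumscribed D A] \/
  degenerate_poncelet C D A.
Proof.
move=> A0 CA AG Aflip.
have /fin_all_exists[l lP] (i : 'I_4) :=
  facing_side (A0 i) (A0 _) (CA i) (CA _) (AG i).
have touch i : (A i == A (ordS i))%MS -> tangent C (l i).
  case: (lP i) => _ _ h /h /eqmxP lE; exists (A i) => //.
  by rewrite /tangent_at CA; apply/eqmxP.
have [/forallP Adist | ] :=
  boolP [forall i, forall j, (i != j) ==> ~~ (A i == A j)%MS].
  left; split=> //.
    split=> // i j; move: (Adist i) => /forallP/(_ j)/implyP; exact.
  move=> i m jm; case: (lP i) => jl tl _.
  have nA : ~~ (A i == A (ordS i))%MS.
    move: (Adist i) => /forallP/(_ (ordS i))/implyP; apply.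
    by case: i {jm jl tl} => -[|[|[|[|]]]].
  have [k k0 lE] := joins_uniq (A0 _) (A0 _) nA jl.
  have [k' k'0 ->] := joins_uniq (A0 _) (A0 _) nA jm.
  rewrite -(scalerK k0 (cross _ _)) -lE.
  by rewrite scalerA; apply: tangentZ; rewrite ?mulf_neq0 ?invr_eq0.
move=> coin; right; exists l.
  move=> i; case: (lP i) => jl tl lE; split=> //; first exact: touch.
  case: (lP (ordS i)) => jm tm mE.
  apply: (facing_turn (A0 i) (A0 _) (CA i) (CA _) (AG i)) => //.
    by rewrite -Aflip.
  by rewrite -Aflip.
have opp i : (A i == A (ordS (ordS i)))%MS -> on_conic D (A (ordS i)).
  rewrite Aflip => /(flip_eqmx (A0 i) (CA i)).
  exact: facing_fixed (A0 i) (CA i) (CA _) (AG i).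
move: coin; rewrite negb_forall => /existsP[i].
rewrite negb_forall => /existsP[j]; rewrite negb_imply negbK => /andP[ij Aij].
(* Distinct indices modulo 4 are adjacent or opposite. *)
have : [|| j == ordS i, i == ordS j | j == ordS (ordS i)].
  by case: i j ij {Aij} => -[|[|[|[|//]]]] Hi [[|[|[|[|//]]]] Hj].
case/or3P=> /eqP ijE.
- by exists i; right; apply: touch; rewrite -ijE.
- by exists j; right; apply: touch; rewrite -ijE andbC.
- by exists (ordS i); left; apply: opp; rewrite -ijE.
Qed.

End StandardFrame.

(** * Solving for the next vertex over an algebraically closed field *)

Lemma sqrt_closed (F : closedFieldType) (x : F) : exists y, y ^+ 2 = x.
Proof.
have [y yE] := @solve_monicpoly F 2 (fun i => if i == 0%N then x else 0) isT.
by exists y; rewrite yE !big_ord_recl big_ord0 /= expr0 mulr1 mul0r !addr0.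
Qed.

Lemma facing_exists (F : closedFieldType) (C : 'M[F]_3) (a b e f : F)
    (p : 'rV[F]_3) :
  (forall p, p *m C = row3 (a * p 0 0) (b * p 0 1) (- (a + b) * p 0 2)) ->
  a + b != 0 -> e ^+ 2 - f ^+ 2 != 0 -> p != 0 -> on_conic C p ->
  exists q, [/\ q != 0, on_conic C q & facing e f p q].
Proof.
move=> polarC ab0 ef0 p0 Cp.
(* G(p, q) is [u x' + v y'], so ([v], [- u]) solves it; [w] then solves the equation of C for z'. *)
set u := e * p 0 0 - f * p 0 1; set v := e * p 0 1 - f * p 0 0.
have [w wE] := sqrt_closed ((a * v ^+ 2 + b * u ^+ 2) / (a + b)).
exists (row3 v (- u) w); split.
- have := facing_line_neq0 polarC ab0 ef0 p0 Cp; apply: contraTneq => /rowP h.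
  move: (h 0) (h 1); rewrite !row3E !mxE -/u -/v => -> /eqP.
  by rewrite oppr_eq0 => ->; rewrite eqxx.
- by rewrite (on_conicE polarC) !row3E wE sqrrN [eqbRHS]mulrC divfK.
- by rewrite /facing !row3E /u /v; ring.
Qed.

Lemma mul_row_mx3 (F : fieldType) (S : 'M[F]_3) (p : 'rV[F]_3) :
  p *m S = row3 (p 0 0 * S 0 0 + p 0 1 * S 1 0 + p 0 2 * S 2 0)
                (p 0 0 * S 0 1 + p 0 1 * S 1 1 + p 0 2 * S 2 1)
                (p 0 0 * S 0 2 + p 0 1 * S 1 2 + p 0 2 * S 2 2).
Proof. by apply: row3_ext; rewrite mulmx3E row3E. Qed.

Lemma quadratic3E (F : fieldType) (S : 'M[F]_3) (p : 'rV[F]_3) : S^T = S ->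
  (p *m S *m p^T == 0) =
  (S 0 0 * p 0 0 ^+ 2 + S 1 1 * p 0 1 ^+ 2 + S 2 2 * p 0 2 ^+ 2
   + 2%:R * (S 0 1 * (p 0 0 * p 0 1) + S 0 2 * (p 0 0 * p 0 2)
             + S 1 2 * (p 0 1 * p 0 2)) == 0).
Proof.
move=> sS; have sym i j : S i j = S j i by rewrite -[in LHS]sS mxE.
rewrite scalar_mx1_eq0 mulmx3E mul_row_mx3 !row3E !mxE.
by rewrite (sym 1 0) (sym 2 0) (sym 2 1); congr (_ == 0); ring.
Qed.

(** * Reduction to the normal form *)

Section NormalForms.

Variable F : fieldType.
Hypothesis two0 : (2%:R : F) != 0.

(** The signs are those of xy, xz, yz at the standard vertices: the nontrivial characters of a group
    of order 4, so orthogonality isolates each unknown up to a factor 8. *)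
Lemma sign_sums_eq0 (s u v w : F) :
  s + 2%:R * (u + v + w) = 0 -> s + 2%:R * (- u + v - w) = 0 ->
  s + 2%:R * (u - v - w) = 0 -> s + 2%:R * (- u - v + w) = 0 ->
  [/\ s = 0, u = 0, v = 0 & w = 0].
Proof.
have eight (x : F) : 2%:R * (2%:R * (2%:R * x)) = 0 -> x = 0.
  by move=> /eqP; rewrite !mulf_eq0 !(negPf two0) /= => /eqP.
set h0 := _ + _; set h1 := _ + _; set h2 := _ + _; set h3 := _ + _.
move=> z0 z1 z2 z3; split; apply: eight.
- transitivity (2%:R * (h0 + h1 + h2 + h3)).
    by rewrite /h0 /h1 /h2 /h3; ring.
  by rewrite z0 z1 z2 z3 !addr0 mulr0.
- transitivity (h0 - h1 + h2 - h3); first by rewrite /h0 /h1 /h2 /h3; ring.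
  by rewrite z0 z1 z2 z3 !subr0 addr0.
- transitivity (h0 + h1 - h2 - h3); first by rewrite /h0 /h1 /h2 /h3; ring.
  by rewrite z0 z1 z2 z3 !subr0 addr0.
- transitivity (h0 - h1 - h2 + h3); first by rewrite /h0 /h1 /h2 /h3; ring.
  by rewrite z0 z1 z2 z3 !subr0 addr0.
Qed.

(** The four incidences kill the trace and the off-diagonal entries; [- (a + b)] is then a diagonal
    entry of an invertible matrix. *)
Lemma inscribed_normal_form (C : 'M[F]_3) :
  is_conic C -> (forall i : 'I_4, on_conic C (standard_vertex F i)) ->
  exists a b,
    (forall p, p *m C = row3 (a * p 0 0) (b * p 0 1) (- (a + b) * p 0 2)) /\
    a + b != 0.
Proof.
move=> /andP[/eqP sC uC] h.
have sym i j : C i j = C j i by rewrite -[in LHS]sC mxE.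
move: (h 0) (h 1) (h 2) (h 3).
rewrite /on_conic !(quadratic3E _ sC) /standard_vertex /= !row3E.
move=> /eqP h0 /eqP h1 /eqP h2 /eqP h3.
have [] := @sign_sums_eq0 (C 0 0 + C 1 1 + C 2 2) (C 0 1) (C 0 2) (C 1 2).
- by rewrite -[RHS]h0; ring.
- by rewrite -[RHS]h1; ring.
- by rewrite -[RHS]h2; ring.
- by rewrite -[RHS]h3; ring.
move=> s c01 c02 c12.
have c22 : C 2 2 = - (C 0 0 + C 1 1) by apply/eqP; rewrite -addr_eq0 addrC s.
have polarC (p : 'rV[F]_3) :
    p *m C = row3 (C 0 0 * p 0 0) (C 1 1 * p 0 1) (- (C 0 0 + C 1 1) * p 0 2).
  rewrite mul_row_mx3 (sym 1 0) (sym 2 0) (sym 2 1) c01 c02 c12 c22.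
  by apply: row3_ext; rewrite !row3E; ring.
exists (C 0 0), (C 1 1); split=> //; apply/eqP => ab0.
have /eqP[] : row3 0 0 1 *m C != 0.
  apply: mulmx_unit_neq0 => //; apply/eqP => /rowP/(_ 2)/eqP.
  by rewrite row3E mxE oner_eq0.
by apply: row3_ext; rewrite polarC !row3E !mxE ?ab0; ring.
Qed.

(** The dual form [invmx D] vanishes at the four sides; sums and differences over opposite sides
    determine it up to e and f. *)
Lemma circumscribed_normal_form (D : 'M[F]_3) : is_conic D ->
  tangent D (row3 1 0 1) -> tangent D (row3 1 0 (-1)) ->
  tangent D (row3 0 1 1) -> tangent D (row3 0 1 (-1)) ->
  exists e f,
  [/\ forall l : 'rV[F]_3, l != 0 ->
        e * (l 0 0 ^+ 2 + l 0 1 ^+ 2 - l 0 2 ^+ 2)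
          + 2%:R * f * l 0 0 * l 0 1 = 0 ->
        tangent D l,
      forall p : 'rV[F]_3,
        e * (e * (p 0 0 ^+ 2 + p 0 1 ^+ 2) - 2%:R * f * p 0 0 * p 0 1) =
          (e ^+ 2 - f ^+ 2) * p 0 2 ^+ 2 ->
        on_conic D p
    & e ^+ 2 - f ^+ 2 != 0].
Proof.
move=> conicD; case/andP: (conicD) => /eqP sD uD.
pose E := invmx D; have sE : E^T = E by rewrite trmx_inv sD.
have uE : E \in unitmx by rewrite unitmx_inv.
have sym i j : E i j = E j i by rewrite -[in LHS]sE mxE.
have nz1 (z : F) : row3 1 0 z != 0 :> 'rV[F]_3.
  by apply/eqP => /rowP/(_ 0)/eqP; rewrite row3E mxE oner_eq0.
have nz2 (z : F) : row3 0 1 z != 0 :> 'rV[F]_3.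
  by apply/eqP => /rowP/(_ 1)/eqP; rewrite row3E mxE oner_eq0.
have tanE (l : 'rV[F]_3) : l != 0 -> tangent D l <->
    E 0 0 * l 0 0 ^+ 2 + E 1 1 * l 0 1 ^+ 2 + E 2 2 * l 0 2 ^+ 2
    + 2%:R * (E 0 1 * (l 0 0 * l 0 1) + E 0 2 * (l 0 0 * l 0 2)
              + E 1 2 * (l 0 1 * l 0 2)) = 0.
  move=> l0; rewrite tangentP //.
  split=> /eqP h; apply/eqP; first by rewrite -(quadratic3E _ sE).
  by rewrite (quadratic3E _ sE).
move=> /(tanE _ (nz1 _)) h1 /(tanE _ (nz1 _)) h2 /(tanE _ (nz2 _)) h3.
move=> /(tanE _ (nz2 _)) h4; rewrite !row3E in h1 h2 h3 h4.
have half (x y : F) : x + 2%:R * y = 0 -> x - 2%:R * y = 0 ->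
    x = 0 /\ y = 0.
  move=> xy1 xy2; have x0 : x = 0.
    apply: (mulfI two0); transitivity ((x + 2%:R * y) + (x - 2%:R * y)).
      by ring.
    by rewrite xy1 xy2 addr0 mulr0.
  split=> //; apply: (mulfI two0); rewrite mulr0.
  by rewrite -[RHS]xy1 x0 add0r.
have [] := half (E 0 0 + E 2 2) (E 0 2).
- by rewrite -[RHS]h1; ring.
- by rewrite -[RHS]h2; ring.
move=> e02 E02; have [] := half (E 1 1 + E 2 2) (E 1 2).
- by rewrite -[RHS]h3; ring.
- by rewrite -[RHS]h4; ring.
move=> e12 E12 {h1 h2 h3 h4}.
have E22 : E 2 2 = - E 0 0 by apply/eqP; rewrite -addr_eq0 addrC e02.
have E11 : E 1 1 = E 0 0 by apply/eqP; rewrite -subr_eq0 -E22 e12.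
set e := E 0 0 in E22 E11; pose f := E 0 1.
have mulE (p : 'rV[F]_3) :
    p *m E = row3 (e * p 0 0 + f * p 0 1) (f * p 0 0 + e * p 0 1)
                  (- e * p 0 2).
  rewrite mul_row_mx3 (sym 1 0) (sym 2 0) (sym 2 1) E02 E12 E22 E11.
  by apply: row3_ext; rewrite !row3E -?/e -?/f; ring.
have tanE' (l : 'rV[F]_3) : l != 0 -> tangent D l <->
    e * (l 0 0 ^+ 2 + l 0 1 ^+ 2 - l 0 2 ^+ 2) + 2%:R * f * l 0 0 * l 0 1 = 0.
  move=> l0; rewrite tanE // E02 E12 E22 E11 -/e -/f.
  by split=> h; rewrite -[RHS]h; ring.
have e0 : e != 0.
  apply/eqP => e0; have /eqP[] : row3 0 0 1 *m E != 0.
    apply: mulmx_unit_neq0 => //; apply/eqP => /rowP/(_ 2)/eqP.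
    by rewrite row3E mxE oner_eq0.
  by rewrite mulE e0; apply: row3_ext; rewrite !row3E !mxE; ring.
(* [E] sends (e, -f, 0) to ([e ^+ 2 - f ^+ 2], 0, 0), and it is injective. *)
have ef0 : e ^+ 2 - f ^+ 2 != 0.
  apply/eqP => ef0; have /eqP[] : row3 e (- f) 0 *m E != 0.
    apply: mulmx_unit_neq0 => //; apply/eqP => /rowP/(_ 0)/eqP.
    by rewrite row3E mxE (negPf e0).
  rewrite mulE; apply: row3_ext; rewrite !row3E mxE; [|by ring|by ring].
  by rewrite -[RHS]ef0; ring.
exists e, f; split=> // [l l0 h|p h]; first exact/tanE'.
(* [l] is the polar of p with respect to D, cleared of denominators; p is on D when [l] satisfies
   the dual equation. *)
pose l : 'rV[F]_3 := row3 (e * (e * p 0 0 - f * p 0 1))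
  (e * (e * p 0 1 - f * p 0 0)) (- (e ^+ 2 - f ^+ 2) * p 0 2).
have lE : (e * (e ^+ 2 - f ^+ 2)) *: p = l *m E.
  by rewrite mulE; apply: row3_ext; rewrite !row3E mxE; ring.
rewrite -(@on_conicZ _ D (e * (e ^+ 2 - f ^+ 2)) p) ?mulf_neq0 //.
rewrite lE /on_conic mulmxKV // trmx_mul sE mulmxA (quadratic3E _ sE).
rewrite E02 E12 E22 E11 -/e -/f /l !row3E.
apply/eqP; transitivity (e * (e ^+ 2 - f ^+ 2) *
  (e * (e * (p 0 0 ^+ 2 + p 0 1 ^+ 2) - 2%:R * f * p 0 0 * p 0 1)
   - (e ^+ 2 - f ^+ 2) * p 0 2 ^+ 2)); first by ring.
by rewrite h subrr mulr0.
Qed.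

End NormalForms.

(** * Transport along a projective map *)

Section ChangeOfCoordinates.

Variables (F : fieldType) (B : 'M[F]_3).
Hypothesis unitB : B \in unitmx.
Implicit Types (p q l : 'rV[F]_3) (S C D : 'M[F]_3) (A : 'I_4 -> 'rV[F]_3).

Let freeB : row_free B. Proof. by rewrite row_free_unit. Qed.
Let unitBT : B^T \in unitmx. Proof. by rewrite unitmx_tr. Qed.
Let freeBT : row_free B^T. Proof. by rewrite row_free_unit. Qed.

Lemma congr_conic S : is_conic S -> is_conic (B *m S *m B^T).
Proof.
case/andP=> /eqP sS uS; rewrite /is_conic !unitmx_mul unitB uS unitBT.
by rewrite !trmx_mul trmxK sS mulmxA eqxx.
Qed.

Lemma congr_on_conic S p : on_conic (B *m S *m B^T) p = on_conic S (p *m B).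
Proof. by rewrite /on_conic trmx_mul !mulmxA. Qed.

(** Points move by [B], so lines move by [B^T] in the opposite direction, which preserves
    incidence. *)
Lemma congr_joins p q l : joins p q (l *m B^T) = joins (p *m B) (q *m B) l.
Proof.
rewrite /joins /incident trmx_mul trmxK !mulmxA; congr (~~ _ && _).
apply/eqP/eqP => [h | ->]; last by rewrite mul0mx.
by rewrite -(mulmxK unitBT l) h mul0mx.
Qed.

Lemma congr_eqmx p q : (p *m B == q *m B)%MS = (p == q)%MS.
Proof. by rewrite !submxMfree. Qed.

Lemma congr_neq0 p : (p *m B != 0) = (p != 0).
Proof.
apply/idP/idP; last exact: mulmx_unit_neq0.
by apply: contra => /eqP ->; rewrite mul0mx.
Qed.

Lemma congr_tangent S l : tangent (B *m S *m B^T) (l *m B^T) <-> tangent S l.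
Proof.
split=> [[p p0 /andP[Sp lE]] | [p p0 /andP[Sp lE]]].
  exists (p *m B); first by rewrite congr_neq0.
  rewrite /tangent_at -congr_on_conic Sp.
  by move: lE; rewrite !mulmxA !submxMfree.
have pE : p = p *m invmx B *m B by rewrite mulmxKV.
exists (p *m invmx B); first by rewrite -congr_neq0 -pE.
by rewrite /tangent_at congr_on_conic -pE Sp !mulmxA -pE !submxMfree.
Qed.

Lemma congr_solution C D A :
  [/\ quadrilateral A, inscribed (B *m C *m B^T) A
    & circumscribed (B *m D *m B^T) A] \/
  degenerate_poncelet (B *m C *m B^T) (B *m D *m B^T) A ->
  let AB := fun i => A i *m B in
  [/\ quadrilateral AB, inscribed C AB & circumscribed D AB] \/
  degenerate_poncelet C D AB.
Proof.
case=> [[[A0 Adist] AC AD] | [l lP [i iP]]]; [left | right].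
  split; first split=> [i | i j ij]; rewrite ?congr_neq0 ?congr_eqmx //.
  - exact: Adist.
  - by move=> i; rewrite -congr_on_conic.
  - by move=> i l; rewrite -congr_joins => /AD/congr_tangent.
pose m j := l j *m invmx B^T.
have lE j : l j = m j *m B^T by rewrite mulmxKV.
exists m; last first.
  exists i; case: iP => h; [left | right]; first by rewrite -congr_on_conic.
  by apply/congr_tangent; rewrite -lE.
move=> {iP}j; case: (lP j) => [[Aj0 Cj] jl tl cl dl]; split.
- by rewrite congr_neq0 -congr_on_conic.
- by rewrite -congr_joins -lE.
- by apply/congr_tangent; rewrite -lE.
- by rewrite congr_eqmx => /cl; rewrite lE => /congr_tangent.
- rewrite -congr_on_conic => h; apply: dl.
  by rewrite !lE (submxMfree _ _ freeBT) (submxMfree _ _ freeBT).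
Qed.

End ChangeOfCoordinates.

Theorem theorem5p1 (F : closedFieldType) (char_neq2 : (2%:R : F) != 0)
    (C D : 'M[F]_3) (conicC : is_conic C) (conicD : is_conic D)
    (exA : exists A : 'I_4 -> 'rV[F]_3,
        [/\ quadrilateral A, inscribed C A & circumscribed D A])
    (P : 'rV[F]_3) (P_neq0 : P != 0) (PC : on_conic C P) :
  exists A : 'I_4 -> 'rV[F]_3,
    (exists i, (A i == P)%MS) /\
    ([/\ quadrilateral A, inscribed C A & circumscribed D A] \/
     degenerate_poncelet C D A).
Proof.
case: exA => A0 [quadA CA DA].
have [B uB AB] := frame conicC char_neq2 quadA CA.
have uBT : B^T \in unitmx by rewrite unitmx_tr.
have cC := congr_conic uB conicC; have cD := congr_conic uB conicD.
have {}CA (i : 'I_4) : on_conic (B *m C *m B^T) (standard_vertex F i).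
  have [k k0 Ai] := AB i.
  by rewrite congr_on_conic -(on_conicZ _ _ k0) -Ai.
have {}DA (i : 'I_4) l :
    joins (standard_vertex F i) (standard_vertex F (ordS i)) l ->
    tangent (B *m D *m B^T) l.
  rewrite -(mulmxKV uBT l) congr_joins // => jl.
  apply/(congr_tangent uB)/(DA i); move: jl; rewrite /joins.
  have [k k0 ->] := AB i; have [k' k'0 ->] := AB (ordS i).
  by rewrite !incidentZ.
have [a [b [polarC ab0]]] := inscribed_normal_form char_neq2 cC CA.
have one0 (x y z : F) : [|| x != 0, y != 0 | z != 0] -> row3 x y z != 0.
  apply: contraTneq => /rowP h; move: (h 0) (h 1) (h 2).
  by rewrite !row3E !mxE => -> -> ->; rewrite eqxx.
have [||||e [f [tanD onD ef0]]] := circumscribed_normal_form char_neq2 cD.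
(* In standard coordinates the sides 0, 1, 2, 3 are x = z, y = -z, x = -z, y = z. *)
- apply: (DA 2); rewrite /joins one0 ?oner_eq0 //= !incident3E !row3E.
  by apply/andP; split; apply/eqP; ring.
- apply: (DA 0); rewrite /joins one0 ?oner_eq0 //= !incident3E !row3E.
  by apply/andP; split; apply/eqP; ring.
- apply: (DA 1); rewrite /joins one0 ?oner_eq0 ?orbT //= !incident3E !row3E.
  by apply/andP; split; apply/eqP; ring.
- apply: (DA 3); rewrite /joins one0 ?oner_eq0 ?orbT //= !incident3E !row3E.
  by apply/andP; split; apply/eqP; ring.
pose p := P *m invmx B; have pE : P = p *m B by rewrite mulmxKV.
have p0 : p != 0 by rewrite -(congr_neq0 uB) -pE.
have Cp : on_conic (B *m C *m B^T) p by rewrite congr_on_conic -pE.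
have [q [q0 Cq pq]] := facing_exists polarC ab0 ef0 p0 Cp.
(* Opposite vertices are mirror images, so [facing_flip] carries the relation once round the
   cycle. *)
pose A (i : 'I_4) := nth 0 [:: p; q; flip p; flip q] i.
exists (fun i => A i *m B); split.
  by exists 0; rewrite pE !submx_refl.
apply: congr_solution => //.
apply: (facing_chain char_neq2 cC polarC tanD onD ab0 ef0).
- by case=> -[|[|[|[|//]]]] Hi; rewrite /A /= ?flip_neq0.
- by case=> -[|[|[|[|//]]]] Hi; rewrite /A /= ?(on_conic_flip polarC).
- case=> -[|[|[|[|//]]]] Hi; rewrite /A /=.
  + exact: pq.
  + exact: facing_flip.
  + exact/facing_flip/facing_flip.
  + have := facing_flip (facing_flip (facing_flip pq)).
    by rewrite flipK.
- by case=> -[|[|[|[|//]]]] Hi; rewrite /A //= flipK.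
Qed.
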